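(* Let $\mathcal H$ be a finite-dimensional real Hilbert space, $\mathcal A:\mathcal H\to 2^{\mathcal H}$ a maximally monotone operator, $\mathcal Q:\mathcal H\to\mathcal H$ a symmetric positive semi-definite linear operator, and suppose $\mathcal T:=(\mathcal A+\mathcal Q)^{-1}\mathcal Q$ is a single-valued operator defined on all of $\mathcal H$ with $\operatorname{Fix}\mathcal T\neq\emptyset$. Let $\gamma\in\,]0,2[$, $\mathcal T_\gamma:=\mathcal I+\gamma(\mathcal T-\mathcal I)$, $b^0\in\mathcal H$, and $b^{k+1}:=\mathcal T_\gamma b^k$ for $k\in\mathbb N$. Then the following hold. (i) $\mathcal T_\gamma$ is $\mathcal Q$-asymptotically regular. (ii) There exists $b^\star\in\operatorname{Fix}\mathcal T$ such that $b^k\to b^\star$ as $k\to\infty$. (iii) For every $b^\star\in\operatorname{Fix}\mathcal T$, $$\|b^{k+1}-b^k\|_{\mathcal Q}\le\frac1{\sqrt{k+1}}\sqrt{\frac{\gamma}{2-\gamma}}\,\|b^0-b^\star\|_{\mathcal Q},\qquad\forall k\in\mathbb N .$$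
   Context: $\mathbb N=\{0,1,2,\dots\}$. $\|a\|_{\mathcal Q}:=\sqrt{\langle\mathcal Qa|a\rangle}$ (a seminorm). $a=\mathcal Tb$ iff $\mathcal Qb\in\mathcal Aa+\mathcal Qa$. $\operatorname{Fix}\mathcal T$ is the set of fixed points of $\mathcal T$ (equal to $\{b:0\in\mathcal Ab\}$). An operator $\mathcal S$ is $\mathcal Q$-asymptotically regular if $\|\mathcal S^{k+1}b-\mathcal S^kb\|_{\mathcal Q}\to0$ as $k\to\infty$ for every $b\in\mathcal H$. *)

(* Defs.v *)
From mathcomp Require Export all_boot all_order all_algebra.
From mathcomp Require Export boolp classical_sets functions reals topology.
From mathcomp Require Export normedtype sequences sesquilinear.
Export Order.TTheory GRing.Theory Num.Theory numFieldNormedType.Exports.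

Set Implicit Arguments.
Unset Strict Implicit.
Unset Printing Implicit Defensive.

Local Open Scope classical_set_scope.
Local Open Scope ring_scope.

(* A finite-dimensional real Hilbert space is a vectType over a realType with
   an inner product ip : {dot H for idfun}, i.e., a positive definite symmetric
   bilinear form (completeness is automatic in finite dimension).  H carries no
   topology; convergence is the one of the norm induced by ip. *)
Section Hilbert.
Variables (R : realType) (H : vectType R) (ip : {dot H for idfun}).

Definition hnorm (x : H) : R := Num.sqrt (ip x x).

Definition hcvg (u : nat -> H) (l : H) : Prop :=
  hnorm (u k - l) @[k --> \oo] --> (0 : R).

Definition monotone_op (A : H -> set H) : Prop :=
  forall x y u v, A x u -> A y v -> 0 <= ip (x - y) (u - v).

(* No monotone operator has a graph properly containing the graph of A. *)
Definition maximally_monotone (A : H -> set H) : Prop :=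
  monotone_op A /\
  forall B, monotone_op B -> (forall x, A x `<=` B x) ->
    forall x, B x `<=` A x.

Definition symmetric_op (Q : {linear H -> H}) : Prop :=
  forall x y, ip (Q x) y = ip x (Q y).

Definition positive_semidefinite (Q : {linear H -> H}) : Prop :=
  forall x, 0 <= ip (Q x) x.

Definition qnorm (Q : {linear H -> H}) (x : H) : R := Num.sqrt (ip (Q x) x).

Definition q_asymptotically_regular (Q : {linear H -> H}) (S : H -> H) : Prop :=
  forall x, qnorm Q (iter k.+1 S x - iter k S x) @[k --> \oo] --> (0 : R).

End Hilbert.

Section SetValued.
Variables (R : realType) (H : vectType R).
Implicit Types (A B : H -> set H) (f : H -> H).

Definition op_of_fun f : H -> set H := fun x => [set f x].

Definition op_add A B : H -> set H :=
  fun x => [set u + v | u in A x & v in B x].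

Definition op_inv A : H -> set H := fun u => [set x | A x u].

Definition op_comp A B : H -> set H := fun x => \bigcup_(y in B x) A y.

(* (A + Q)^-1 Q as a composition of set-valued operators *)
Definition ppp_op A (Q : {linear H -> H}) : H -> set H :=
  op_comp (op_inv (op_add A (op_of_fun Q))) (op_of_fun Q).

Lemma ppp_opE A (Q : {linear H -> H}) b a :
  ppp_op A Q b a <-> exists2 u, A a u & Q b = u + Q a.
Proof.
split=> [[_ ->] [u Au [_ ->] e]|[u Au e]]; first by exists u.
by exists (Q b) => //; exists u => //; exists (Q a).
Qed.

Definition fixed_points f : set H := [set x | f x = x].

Definition relaxed (gamma : R) f : H -> H := fun x => x + gamma *: (f x - x).

End SetValued.

(* Main.v *)
Require Import Defs.
From HB Require Import structures.
From mathcomp Require Import ring lra.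

(* Monotonicity of [A] makes the relaxed iteration Fejer monotone for the
   [Q]-seminorm with respect to [Fix T]; summing the decrease and using that the
   steps are nonincreasing gives the [1/sqrt (k+1)] rate, hence asymptotic
   regularity.  Since [Q] is only semidefinite this does not bound [b k] itself.
   Single-valuedness of [T] does bound [T (b k)], by a recession argument on
   [A], and maximality of [A] shows that the limits of [T (b k)] along
   ultrafilters are fixed points.  Two such limits are at [Q]-distance zero, and
   a fixed point is determined by its image under [Q], so [T (b k)] converges.
   As [b k.+1] is [(1 - gamma) *: b k + gamma *: T (b k)] with
   [`|1 - gamma| < 1], [b] has the same limit. *)

Set Implicit Arguments.
Unset Strict Implicit.
Unset Printing Implicit Defensive.

Local Open Scope classical_set_scope.
Local Open Scope ring_scope.

(** * The seminorm of a symmetric positive semidefinite operator *)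

Section SemiNorm.
Variables (R : realType) (H : vectType R) (ip : {dot H for idfun}).
Implicit Types (x y z : H) (a : R) (Q : {linear H -> H}).

Lemma ip_sym x y : ip x y = ip y x.
Proof. by rewrite hermC expr0 mul1r. Qed.

Lemma ipZl a x y : ip (a *: x) y = a * ip x y.
Proof. by rewrite linearZl_LR. Qed.

Lemma ipZr a x y : ip x (a *: y) = a * ip x y.
Proof. by rewrite ip_sym ipZl ip_sym. Qed.

Lemma ipDl x y z : ip (x + y) z = ip x z + ip y z.
Proof. by rewrite linearDl. Qed.

Lemma ipDr x y z : ip z (x + y) = ip z x + ip z y.
Proof. by rewrite linearDr. Qed.

Lemma ipBr x y z : ip z (x - y) = ip z x - ip z y.
Proof. by rewrite linearBr. Qed.

Lemma ip_suml (I : finType) (f : I -> H) y :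
  ip (\sum_i f i) y = \sum_i ip (f i) y.
Proof. by rewrite linear_sumlz. Qed.

Lemma ip_gt0 x : x != 0 -> 0 < ip x x.
Proof. exact: neq0_dnorm_gt0. Qed.

Lemma ip_ge0 x : 0 <= ip x x.
Proof.
by have [->|/ip_gt0/ltW//] := eqVneq x 0; rewrite linear0l.
Qed.

Variable Q : {linear H -> H}.
Hypotheses (Q_sym : symmetric_op ip Q) (Q_psd : positive_semidefinite ip Q).

Local Notation q := (qnorm ip Q).

Lemma qform_sym x y : ip (Q x) y = ip (Q y) x.
Proof. by rewrite Q_sym ip_sym. Qed.

Lemma qform_comb a c x y :
  ip (Q (a *: x + c *: y)) (a *: x + c *: y) =
  a ^+ 2 * ip (Q x) x + a * c * ip (Q x) y *+ 2 + c ^+ 2 * ip (Q y) y.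
Proof.
rewrite (linearD Q) !(linearZ_LR Q) ipDl !ipDr !ipZl !ipZr (qform_sym y x).
ring.
Qed.

Lemma qnorm_ge0 x : 0 <= q x.
Proof. exact: sqrtr_ge0. Qed.

Lemma sqr_qnorm x : q x ^+ 2 = ip (Q x) x.
Proof. exact/sqr_sqrtr/Q_psd. Qed.

(** The quadratic form is nonnegative on all combinations of [x] and [y]. As it may vanish at a
    nonzero [y], the case [C = 0] is treated apart. *)
Lemma qform_CauchySchwarz x y : `|ip (Q x) y| <= q x * q y.
Proof.
rewrite /qnorm -sqrtrM ?Q_psd // -sqrtr_sqr ler_wsqrtr //.
have p a c : 0 <= a ^+ 2 * ip (Q x) x + a * c * ip (Q x) y *+ 2
                  + c ^+ 2 * ip (Q y) y.
  by rewrite -qform_comb Q_psd.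
move: (Q_psd x) (Q_psd y) p.
set A := ip (Q x) x; set B := ip (Q x) y; set C := ip (Q y) y => A0 C0 p.
have [C_eq0|C_neq0] := eqVneq C 0.
  suff -> : B = 0 by rewrite expr0n mulr_ge0.
  apply/eqP/negPn/negP => B0.
  (* With [C = 0] the form is affine in the coefficient of [y]; this coefficient gives it the value
     [-1]. *)
  have := p 1 (- (A + 1) / (2 * B)); rewrite C_eq0.
  have -> : 1 ^+ 2 * A + 1 * (- (A + 1) / (2 * B)) * B *+ 2
            + (- (A + 1) / (2 * B)) ^+ 2 * 0 = -1 by field.
  by rewrite ler0N1.
have {C0 C_neq0} C0 : 0 < C by rewrite lt_neqAle eq_sym C_neq0.
have := p C (- B).
have -> : C ^+ 2 * A + C * - B * B *+ 2 + (- B) ^+ 2 * C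
          = C * (A * C - B ^+ 2) by ring.
by rewrite pmulr_rge0 // subr_ge0.
Qed.

Lemma qnormZ a x : q (a *: x) = `|a| * q x.
Proof.
rewrite /qnorm (linearZ_LR Q) ipZl ipZr mulrA -expr2 sqrtrM ?sqr_ge0 //.
by rewrite sqrtr_sqr.
Qed.

Lemma qnormN x : q (- x) = q x.
Proof. by rewrite -scaleN1r qnormZ normrN1 mul1r. Qed.

Lemma qnormB x y : q (x - y) = q (y - x).
Proof. by rewrite -opprB qnormN. Qed.

Lemma ler_qnormD x y : q (x + y) <= q x + q y.
Proof.
rewrite -ler_sqr ?nnegrE ?addr_ge0 ?qnorm_ge0 // sqr_qnorm.
have /= := qform_comb 1 1 x y; rewrite !scale1r => ->.
rewrite -!sqr_qnorm; have := qform_CauchySchwarz x y.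
move/(le_trans (ler_norm _)); nra.
Qed.

Lemma ler_qnorm_dist x y z : q (x - z) <= q (x - y) + q (y - z).
Proof. by apply: le_trans (ler_qnormD _ _); rewrite addrA subrK. Qed.

Lemma qnorm_sum (I : finType) (f : I -> H) : q (\sum_i f i) <= \sum_i q (f i).
Proof.
elim/big_ind2: _ => [||//]; first by rewrite /qnorm linear0r sqrtr0.
by move=> x1 x2 y1 y2 h1 h2; exact: le_trans (ler_qnormD _ _) (lerD h1 h2).
Qed.

(** Cauchy-Schwarz for [x] and [Q x] bounds the squared norm of [Q x] by zero. *)
Lemma qnorm_eq0 x : q x = 0 -> Q x = 0.
Proof.
move=> q0; apply/eqP/negPn/negP => /ip_gt0.
have := qform_CauchySchwarz x (Q x).
by rewrite q0 mul0r normr_le0 => /eqP ->; rewrite ltxx.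
Qed.

End SemiNorm.

(** * The Hilbert norm and coordinates in a basis *)

Section HilbertNorm.
Variables (R : realType) (H : vectType R) (ip : {dot H for idfun}).
Implicit Types (x y z : H) (a : R).

Local Notation hn := (hnorm ip).

(** For the identity operator, [qnorm] is [hnorm], so the seminorm inequalities carry over. *)
Lemma id_sym : symmetric_op ip (idfun : {linear H -> H}).
Proof. by []. Qed.

Lemma id_psd : positive_semidefinite ip (idfun : {linear H -> H}).
Proof. exact: ip_ge0. Qed.

Lemma hnorm_ge0 x : 0 <= hn x.
Proof. exact: sqrtr_ge0. Qed.

Lemma CauchySchwarz x y : `|ip x y| <= hn x * hn y.
Proof. exact: (qform_CauchySchwarz id_sym id_psd). Qed.

Lemma hnormZ a x : hn (a *: x) = `|a| * hn x.
Proof. exact: (qnormZ ip (idfun : {linear H -> H})). Qed.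

Lemma ler_hnormD x y : hn (x + y) <= hn x + hn y.
Proof. exact: (ler_qnormD id_sym id_psd). Qed.

Local Notation n := (\dim (@fullv R H)).
Local Notation e := (vbasis (@fullv R H)).

Lemma coord_basisE x : x = \sum_(i < n) coord e i x *: e`_i.
Proof. exact: coord_vbasis (memvf x). Qed.

(** Riesz representation of coordinates. The map sending [y] to its inner products with the basis is
    injective by definiteness, hence onto by dimension; [y] is a preimage of the [j]-th unit row. *)
Lemma coord_riesz (j : 'I_n) : exists y, forall x, coord e j x = ip x y.
Proof.
pose g y : 'rV[R]_n := \row_(i < n) ip e`_i y.
have g_lin : linear g.
  by move=> a u v; apply/rowP => i; rewrite !mxE (ipDr ip) (ipZr ip).
pose gL := HB.pack_for {linear H -> 'rV[R]_n} g
  (GRing.isLinear.Build R H 'rV[R]_n *:%R g g_lin).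
pose G : 'Hom(H, 'rV[R]_n) := linfun gL.
have GE y i : G y 0 i = ip e`_i y by rewrite lfunE /= mxE.
have kerG : lker G == 0%VS.
  apply/eqP/vspaceP => y; rewrite memv_ker memv0; apply/eqP/eqP => [Gy|->].
    apply/eqP/negPn/negP => /(ip_gt0 ip).
    rewrite [X in ip X y]coord_basisE ip_suml big1 ?ltxx // => i _.
    by rewrite ipZl -GE Gy mxE mulr0.
  by rewrite linear0.
have imG : limg G = fullv.
  apply/eqP; rewrite eqEdim subvf limg_dim_eq ?(eqP kerG) ?capv0 //.
  by rewrite !dimvf /dim /= mul1n.
have /memv_imgP[y _ Gy] : (delta_mx 0 j : 'rV[R]_n) \in limg G.
  by rewrite imG memvf.
exists y => x; rewrite [in RHS](coord_basisE x) ip_suml (bigD1 j) //=.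
rewrite ipZl -GE -Gy mxE !eqxx mulr1 big1 ?addr0 // => i ij.
by rewrite ipZl -GE -Gy mxE (negPf ij) andbF mulr0.
Qed.

(** Expand [x] in the basis and bound each coordinate by Cauchy-Schwarz against its Riesz vector. *)
Lemma qnorm_bounded (Q : {linear H -> H}) :
  symmetric_op ip Q -> positive_semidefinite ip Q ->
  exists2 C, 0 <= C & forall x, qnorm ip Q x <= C * hn x.
Proof.
move=> Q_sym Q_psd; have [y yP] := choice coord_riesz.
exists (\sum_(i < n) hn (y i) * qnorm ip Q e`_i).
  by apply: sumr_ge0 => i _; rewrite mulr_ge0 ?hnorm_ge0 ?qnorm_ge0.
move=> x; rewrite {1}[x]coord_basisE mulr_suml.
apply: le_trans (qnorm_sum Q_sym Q_psd _) _; apply: ler_sum => i _.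
rewrite qnormZ mulrAC ler_wpM2r ?qnorm_ge0 // yP mulrC.
exact: CauchySchwarz.
Qed.

End HilbertNorm.

(** * Convergence along ultrafilters *)

Section Ultrafilters.
Variables (I : Type) (F : set_system I).

Lemma cvg_ultra (T : topologicalType) {FF : Filter F} (f : I -> T) (l : T) :
  (forall G, UltraFilter G -> F `<=` G -> f k @[k --> G] --> l) ->
  f k @[k --> F] --> l.
Proof.
move=> fl B Bl; apply: contrapT => nFB.
have wF : ProperFilter (within (~` (f @^-1` B)) F).
  apply: Build_ProperFilter_ex => P FP; apply: contrapT => nP; apply: nFB.
  apply: (@filterS _ F _ [set k | (~` (f @^-1` B)) k -> P k]) FP => k /= PB; apply: contrapT => nB.
  by apply: nP; exists k; exact: PB.
have [G [GU FG]] := ultraFilterLemma wF.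
have GF : F `<=` G by move=> P FP; apply: FG; apply: (@filterS _ F _ P) FP.
have GB : G (f @^-1` B) by exact: (fl G GU GF B Bl).
have GnB : G (~` (f @^-1` B)) by apply: FG; exact: withinT.
by have [k []] := filter_ex (filterI GB GnB).
Qed.

Lemma squeeze_cvg0 (R : realFieldType) {FF : Filter F} (f g : I -> R) :
  (\forall k \near F, `|f k| <= g k) -> g k @[k --> F] --> 0 ->
  f k @[k --> F] --> 0.
Proof.
move=> fg g0; apply: (@squeeze_cvgr _ _ _ _ (fun k => - g k) g) => //.
  by near do rewrite -ler_norml.
by rewrite -[0]oppr0; exact: cvgN.
Unshelve. all: by end_near. Qed.

(** Compactness of the segment gives a cluster point, and a cluster point of an ultrafilter is a
    limit. *)
Lemma ultra_bounded_cvg (R : realType) (FU : UltraFilter F) (r : I -> R) M :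
  (\forall k \near F, `|r k| <= M) -> exists l : R, r k @[k --> F] --> l.
Proof.
move=> rM.
have [|l [_ lc]] := @segment_compact R (- M) M (r @ F) _.
  by apply: filterS rM => k /=; rewrite in_itv /= -ler_norml.
exists l => B Bl; have [//|nB] := in_ultra_setVsetC (r @^-1` B) FU.
by have [x []] := lc (~` B) B nB Bl.
Qed.

End Ultrafilters.

(** * Norm limits in [H] along filters *)

Section HilbertUltra.
Variables (R : realType) (H : vectType R) (ip : {dot H for idfun}).
Variables (I : Type) (F : set_system I).
Local Notation hn := (hnorm ip).

Lemma hcvg_weak {FF : Filter F} (u : I -> H) l z :
  hn (u k - l) @[k --> F] --> (0 : R) -> ip (u k) z @[k --> F] --> ip l z.
Proof.
move=> ul; apply/subr_cvg0.
apply: (@squeeze_cvg0 _ _ _ _ _ (fun k => hn (u k - l) * hn z)).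
  by apply: filterE => k; rewrite -linearBl CauchySchwarz.
by rewrite -[X in _ --> X](mul0r (hn z)); exact: cvgMr_tmp.
Qed.

Lemma qcvg {FF : Filter F} (Q : {linear H -> H}) (u : I -> H) l :
  symmetric_op ip Q -> positive_semidefinite ip Q ->
  hn (u k - l) @[k --> F] --> (0 : R) ->
  qnorm ip Q (u k - l) @[k --> F] --> (0 : R).
Proof.
move=> Q_sym Q_psd ul; have [C C0 QC] := qnorm_bounded Q_sym Q_psd.
apply: (@squeeze_cvg0 _ _ _ _ _ (fun k => C * hn (u k - l))).
  by apply: filterE => k; rewrite ger0_norm ?qnorm_ge0.
by rewrite -[X in _ --> X](mulr0 C); exact: cvgMl_tmp.
Qed.

(** Bolzano-Weierstrass: each coordinate is bounded, hence converges along [F], and the limits are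
    reassembled in the basis. *)
Lemma ultra_hcvg (FU : UltraFilter F) (u : I -> H) M :
  (\forall k \near F, hn (u k) <= M) ->
  exists l, hn (u k - l) @[k --> F] --> (0 : R).
Proof.
move=> uM; pose n := \dim (@fullv R H); pose e := vbasis (@fullv R H).
have coord_cvg (i : 'I_n) : exists l : R, coord e i (u k) @[k --> F] --> l.
  have [y yP] := coord_riesz ip i.
  apply: (@ultra_bounded_cvg _ _ _ _ _ (M * hn y)); apply: filterS uM => k uk.
  rewrite yP; apply: le_trans (CauchySchwarz _ _ _) _.
  by rewrite ler_wpM2r ?hnorm_ge0.
have [l lP] := choice coord_cvg.
exists (\sum_(i < n) l i *: e`_i).
apply: (@squeeze_cvg0 _ _ _ _ _
  (fun k => \sum_(i < n) `|coord e i (u k) - l i| * hn e`_i)).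
  apply: filterE => k; rewrite ger0_norm ?hnorm_ge0 //.
  rewrite {1}[u k]coord_basisE -sumrB.
  apply: le_trans (qnorm_sum (@id_sym _ _ ip) (@id_psd _ _ ip) _) _.
  by apply: ler_sum => i _; rewrite -scalerBl -hnormZ.
have := @cvg_big R 'I_n +%R 0 xpredT (@add_continuous R) I F (index_enum _)
  (fun i k => `|coord e i (u k) - l i| * hn e`_i) (fun=> 0) _.
rewrite big1 //; apply=> i _; rewrite -[X in _ --> X](mul0r (hn e`_i)).
apply: cvgMr_tmp; rewrite -(@normr0 _ R); apply: cvg_norm.
exact/subr_cvg0/lP.
Qed.

End HilbertUltra.

(** * Real sequences tending to zero *)

Section Asymptotics.
Variable R : realType.

Lemma sqr_cvg0 (I : Type) (F : set_system I) {FF : Filter F} (f : I -> R) :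
  f k ^+ 2 @[k --> F] --> (0 : R) -> f k @[k --> F] --> (0 : R).
Proof.
move=> f0; apply/cvgr0Pnorm_lt => e e0.
near=> k; rewrite -ltr_sqr ?nnegrE ?(ltW e0) // -normrX; near: k.
exact: (@cvgr0_norm_lt _ _ _ _ _ _ f0 (e ^+ 2) (exprn_gt0 _ e0)).
Unshelve. all: by end_near. Qed.

Lemma contraction_cvg0 (q : R) (e d : nat -> R) :
  0 <= q < 1 -> (forall k, 0 <= e k) ->
  (forall k, e k.+1 <= q * e k + d k) ->
  d k @[k --> \oo] --> (0 : R) -> e k @[k --> \oo] --> (0 : R).
Proof.
move=> /andP[q0 q1] e0 ed d0; apply/cvgr0Pnorm_lt => eps eps0.
(* With this threshold on [d], the value [eps / 2] is fixed by the map sending [t] to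
   [q * t + (1 - q) * (eps / 2)], so the excess of [e] over it shrinks by [q] at each step. *)
have h0 : 0 < (1 - q) * (eps / 2).
  by rewrite mulr_gt0 ?subr_gt0 // divr_gt0.
have [N _ dN] := @cvgr0_norm_lt _ _ _ _ _ _ d0 _ h0.
have eN m : e (N + m)%N <= eps / 2 + q ^+ m * e N.
  elim: m => [|m IH]; first by rewrite addn0 expr0 mul1r ler_wpDl // divr_ge0 ?ltW.
  rewrite addnS exprS; have := ed (N + m)%N; have := dN (N + m)%N (leq_addr _ _).
  move=> /= /(le_lt_trans (ler_norm _)); move: IH.
  move=> /(ler_wpM2l q0); lra.
have qN : q ^+ m * e N @[m --> \oo] --> (0 : R).
  rewrite -[X in _ --> X](mul0r (e N)); apply: cvgMr_tmp; apply: cvg_expr.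
  by rewrite ger0_norm.
have h2 : 0 < eps / 2 by rewrite divr_gt0.
have [M _ MP] := @cvgr0_norm_lt _ _ _ _ _ _ qN _ h2.
exists (N + M)%N => // k /= NMk; rewrite ger0_norm ?e0 //.
have Nk : (N <= k)%N by rewrite (leq_trans _ NMk) ?leq_addr.
rewrite -(subnKC Nk); apply: le_lt_trans (eN _) _.
have := MP (k - N)%N; rewrite /= leq_subRL // => /(_ NMk).
move=> /(le_lt_trans (ler_norm _)); lra.
Qed.

End Asymptotics.

(** * Fixed points and nonexpansiveness of the preconditioned operator *)

Section PreconditionedProximalPoint.
Variables (R : realType) (H : vectType R) (ip : {dot H for idfun}).
Variables (A : H -> set H) (Q : {linear H -> H}) (T : H -> H).
Hypotheses (A_maxmon : maximally_monotone ip A).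
Hypotheses (Q_sym : symmetric_op ip Q) (Q_psd : positive_semidefinite ip Q).
Hypothesis T_def : forall x, ppp_op A Q x = [set T x].
Implicit Types x y z u : H.

Local Notation q := (qnorm ip Q).
Local Notation hn := (hnorm ip).

(** Adjoining the pair of [a] and [w] to the graph keeps it monotone, so maximality already puts it
    there. *)
Lemma maximally_monotoneP a w :
  (forall x u, A x u -> 0 <= ip (a - x) (w - u)) -> A a w.
Proof.
move=> aw; have [A_mon A_max] := A_maxmon.
apply: (A_max (fun x => A x `|` [set v | x = a /\ v = w])).
- move=> x y u v [Au|[-> ->]] [Av|[-> ->]].
  + exact: A_mon.
  + by rewrite -opprB -[u - w]opprB linearNl linearNr opprK; exact: aw.
  + exact: aw.
  + by rewrite subrr linear0l.
- by move=> x u; left.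
- by right.
Qed.

Lemma ppp_mem x : A (T x) (Q (x - T x)).
Proof.
have /ppp_opE[u Au xE] : ppp_op A Q x (T x) by rewrite T_def.
by rewrite linearB xE addrK.
Qed.

Lemma ppp_unique x y : A y (Q (x - y)) -> y = T x.
Proof.
move=> Ay; suff : ppp_op A Q x y by rewrite T_def.
by apply/ppp_opE; exists (Q (x - y)) => //; rewrite -linearD subrK.
Qed.

Lemma fixed_pointsP x : fixed_points T x <-> A x 0.
Proof.
split=> [Tx|Ax]; last by apply/esym/ppp_unique; rewrite subrr linear0.
by have := ppp_mem x; rewrite Tx subrr linear0.
Qed.

(** Here [Q (y - x) = 0], which lies in [A x]; hence [x] is a value of [T] at [y], and
    single-valuedness gives [x = T y = y]. *)
Lemma fixed_points_inj x y :
  fixed_points T x -> fixed_points T y -> q (x - y) = 0 -> x = y.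
Proof.
move=> /fixed_pointsP Ax yT qxy; rewrite -[y]yT; apply: ppp_unique.
by rewrite (qnorm_eq0 Q_sym Q_psd) // qnormB.
Qed.

Lemma relaxedE (gamma : R) x : relaxed gamma T x = (1 - gamma) *: x + gamma *: T x.
Proof. by rewrite /relaxed scalerBr scalerBl scale1r addrA addrAC. Qed.

(** With [e = x - y] and [d = T x - T y], monotonicity of [A] says [0 <= ip d (Q (e - d))], that is,
    [T] is firmly nonexpansive for [q]. The right side minus the left is [2 * gamma] times this
    quantity. *)
Lemma relaxed_qnonexpansive (gamma : R) x y : 0 <= gamma ->
  q (relaxed gamma T x - relaxed gamma T y) ^+ 2 <=
  q (x - y) ^+ 2
    - gamma * (2 - gamma) * q ((x - T x) - (y - T y)) ^+ 2.
Proof.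
move=> g0; have [A_mon _] := A_maxmon.
have := A_mon _ _ _ _ (ppp_mem x) (ppp_mem y).
rewrite -(linearB Q) !sqr_qnorm //.
pose e := x - y; pose d := T x - T y.
have rE : (x - T x) - (y - T y) = 1 *: e + (-1) *: d.
  by rewrite scale1r scaleN1r /e /d !opprD addrACA.
have -> : relaxed gamma T x - relaxed gamma T y
          = (1 - gamma) *: e + gamma *: d.
  by rewrite !relaxedE opprD addrACA -!scalerBr.
rewrite rE -/e -/d !qform_comb // -Q_sym ipDr ipZr ipZr qform_sym //.
move=> /(mulr_ge0 g0); lra.
Qed.

(** * Fejer monotonicity and the rate *)

Section Iteration.
Variables (gamma : R) (b : nat -> H).
Hypothesis gamma_bnd : 0 < gamma < 2.
Hypothesis b_step : forall k, b k.+1 = relaxed gamma T (b k).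

Let gamma_gt0 : 0 < gamma. Proof. by case/andP: gamma_bnd. Qed.
Let gamma_lt2 : gamma < 2. Proof. by case/andP: gamma_bnd. Qed.

Lemma step_qnorm k : q (b k.+1 - b k) = gamma * q (b k - T (b k)).
Proof.
rewrite b_step /relaxed [_ + gamma *: _]addrC addrK qnormZ gtr0_norm //.
by rewrite qnormB.
Qed.

(** The residual of [z] vanishes; the weight [(2 - gamma) / gamma] arises because a step is [gamma]
    times a residual. *)
Lemma fejer z k : fixed_points T z ->
  q (b k.+1 - z) ^+ 2 + (2 - gamma) / gamma * q (b k.+1 - b k) ^+ 2
    <= q (b k - z) ^+ 2.
Proof.
move=> Tz; rewrite step_qnorm exprMn.
have := relaxed_qnonexpansive (b k) z (ltW gamma_gt0).
have -> : relaxed gamma T z = z by rewrite /relaxed Tz subrr scaler0 addr0.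
rewrite Tz subrr subr0 -b_step.
have -> : (2 - gamma) / gamma * (gamma ^+ 2 * q (b k - T (b k)) ^+ 2)
  = gamma * (2 - gamma) * q (b k - T (b k)) ^+ 2.
  by field; rewrite gt_eqF.
lra.
Qed.

Lemma fejer_qnorm z j k : fixed_points T z -> (j <= k)%N ->
  q (b k - z) <= q (b j - z).
Proof.
move=> Tz /subnKC <-; elim: (k - j)%N => [|m IH]; first by rewrite addn0.
apply: le_trans IH; rewrite addnS -ler_sqr ?nnegrE ?qnorm_ge0 //.
apply: le_trans (fejer _ Tz); rewrite lerDl mulr_ge0 ?sqr_ge0 //.
by rewrite divr_ge0 ?ltW // subr_gt0.
Qed.

(** Nonexpansiveness of the relaxed map at two consecutive iterates. *)
Lemma step_qnorm_noninc k : q (b k.+2 - b k.+1) <= q (b k.+1 - b k).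
Proof.
rewrite -ler_sqr ?nnegrE ?qnorm_ge0 // {1}b_step [X in _ - X]b_step.
apply: le_trans (relaxed_qnonexpansive _ _ (ltW gamma_gt0)) _.
rewrite lerBlDr lerDl mulr_ge0 ?sqr_ge0 // mulr_ge0 ?ltW //.
by rewrite subr_gt0.
Qed.

(** Telescoping of [fejer], with each of the [k.+1] steps replaced by the last, which is the
    smallest. *)
Lemma sum_step_qnorm z k : fixed_points T z ->
  q (b k.+1 - z) ^+ 2
    + k.+1%:R * ((2 - gamma) / gamma * q (b k.+1 - b k) ^+ 2)
  <= q (b 0%N - z) ^+ 2.
Proof.
move=> Tz; elim: k => [|k IH]; first by rewrite mul1r; exact: fejer.
apply: le_trans IH; rewrite -[k.+2%:R]natr1 mulrDl mul1r.
rewrite addrCA addrC; apply: lerD; first exact: fejer.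
rewrite ler_wpM2l // ler_wpM2l ?ler_sqr ?nnegrE ?qnorm_ge0 ?step_qnorm_noninc //.
by rewrite divr_ge0 ?ltW // subr_gt0.
Qed.

Lemma sqr_step_qnorm_rate z k : fixed_points T z ->
  q (b k.+1 - b k) ^+ 2
    <= k.+1%:R^-1 * (gamma / (2 - gamma)) * q (b 0%N - z) ^+ 2.
Proof.
move=> Tz; have g2 : 0 < 2 - gamma by rewrite subr_gt0.
have k0 : 0 < k.+1%:R :> R by rewrite ltr0n.
have qz := sqr_ge0 (q (b k.+1 - z)).
have := sum_step_qnorm k Tz.
set D := q (b k.+1 - b k) ^+ 2; set E := q (b 0%N - z) ^+ 2.
move=> /(le_trans (ler_wpDl qz (lexx _))).
have -> : k.+1%:R^-1 * (gamma / (2 - gamma)) * E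
  = E / (k.+1%:R * ((2 - gamma) / gamma)).
  by field; rewrite !gt_eqF //= addrC natr1.
by rewrite ler_pdivlMr ?mulr_gt0 ?invr_gt0 // [D * _]mulrC mulrA.
Qed.

Lemma step_qnorm_rate z k : fixed_points T z ->
  q (b k.+1 - b k)
    <= 1 / Num.sqrt (k.+1%:R) * Num.sqrt (gamma / (2 - gamma))
       * q (b 0%N - z).
Proof.
move=> Tz; have g2 : 0 <= gamma / (2 - gamma).
  by rewrite divr_ge0 ?subr_ge0 // ltW.
rewrite -ler_sqr ?nnegrE ?qnorm_ge0 //; last first.
  by rewrite !mulr_ge0 ?invr_ge0 ?sqrtr_ge0.
rewrite !exprMn expr1n mul1r exprVn (sqr_sqrtr g2) (sqr_sqrtr (ler0n R k.+1)).
exact: sqr_step_qnorm_rate.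
Qed.

Lemma step_qnorm_cvg0 : fixed_points T !=set0 ->
  q (b k.+1 - b k) @[k --> \oo] --> (0 : R).
Proof.
move=> [z Tz]; apply: sqr_cvg0.
pose C := (gamma / (2 - gamma)) * q (b 0%N - z) ^+ 2.
(* [harmonic k] is the inverse of [k.+1], matching the rate. *)
apply: (@squeeze_cvg0 _ _ _ _ _ (fun k => harmonic k * C)).
  apply: filterE => k; rewrite ger0_norm ?sqr_ge0 // /C mulrA.
  exact: sqr_step_qnorm_rate.
rewrite -[X in _ --> X](mul0r C); apply: cvgMr_tmp; exact: cvg_harmonic.
Qed.

Hypothesis FixT : fixed_points T !=set0.

Lemma residual_cvg0 : q (b k - T (b k)) @[k --> \oo] --> (0 : R).
Proof.
have -> : (fun k => q (b k - T (b k))) = (fun k => gamma^-1 * q (b k.+1 - b k)).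
  by apply/funext => k; rewrite step_qnorm mulKf ?gt_eqF.
rewrite -[X in _ --> X](mulr0 gamma^-1); apply: cvgMl_tmp.
exact: step_qnorm_cvg0.
Qed.

Lemma ppp_qnorm z k : fixed_points T z -> q (T (b k) - z) <= q (b k - z).
Proof.
move=> Tz; rewrite -ler_sqr ?nnegrE ?qnorm_ge0 //.
(* At relaxation parameter 1 the relaxed map is [T] itself. *)
have := relaxed_qnonexpansive (b k) z (@ler01 R).
rewrite !relaxedE subrr !scale0r !add0r !scale1r Tz => /le_trans; apply.
by rewrite lerBlDr lerDl mulr_ge0 ?sqr_ge0 // mul1r; lra.
Qed.

(** Monotonicity between [T (b k)] and [x] trades [u] for [Q (b k - T (b k))]; Cauchy-Schwarz for
    [Q] and Fejer monotonicity finish. The right side tends to zero even when no bound on [T (b k)]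
    is known. *)
Lemma graph_bound z x u k : fixed_points T z -> A x u ->
  ip (T (b k) - x) u
    <= (q (b 0%N - z) + q (z - x)) * q (b k - T (b k)).
Proof.
move=> Tz Au; have [A_mon _] := A_maxmon.
have := A_mon _ _ _ _ (ppp_mem (b k)) Au; rewrite ipBr subr_ge0 => /le_trans.
apply; rewrite -Q_sym; apply: le_trans (ler_norm _) _.
apply: le_trans (qform_CauchySchwarz Q_sym Q_psd _ _) _.
rewrite ler_wpM2r ?qnorm_ge0 //.
apply: le_trans (ler_qnorm_dist Q_sym Q_psd _ z _) _; rewrite lerD2r.
by apply: le_trans (ppp_qnorm _ Tz) _; exact: fejer_qnorm.
Qed.

(** * Limits of [T (b k)] along ultrafilters refining [\oo] *)

Section UltraLimit.
Variable F : set_system nat.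
Hypotheses (FU : UltraFilter F) (oF : \oo `<=` F).

Lemma residual_ultra_cvg0 : q (b k - T (b k)) @[k --> F] --> (0 : R).
Proof. by move=> B B0; apply: oF; exact: residual_cvg0. Qed.

(* If [T (b k)] were unbounded, a limit direction [d] of it would satisfy
   [Q d = 0] and be a recession direction of [A^-1 0], so that [z + d] would be
   a second value of [T] at a fixed point [z]. *)
Lemma ppp_ultra_bounded : exists M, \forall k \near F, hn (T (b k)) <= M.
Proof.
apply: contrapT => unbounded; have [z Tz] := FixT.
have large M : \forall k \near F, M < hn (T (b k)).
  have [hM|] := in_ultra_setVsetC [set k | hn (T (b k)) <= M] FU.
    by case: unbounded; exists M.
  by apply: filterS => k /= /negP; rewrite -ltNge.
pose w k := (hn (T (b k)))^-1 *: T (b k).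
have inv_cvg0 : (hn (T (b k)))^-1 @[k --> F] --> (0 : R).
  by apply/gtr0_cvgV0; [exact: large|apply/cvgryPgt => M; exact: large].
have hw : \forall k \near F, hn (w k) = 1.
  apply: filterS (large 0) => k k0.
  by rewrite hnormZ ger0_norm ?invr_ge0 ?hnorm_ge0 // mulVf ?gt_eqF.
have [d wd] : exists d, hn (w k - d) @[k --> F] --> (0 : R).
  by apply: (@ultra_hcvg _ _ _ _ _ _ _ 1); apply: filterS hw => k ->.
have d_neq0 : d <> 0.
  move=> d0; suff : (1 : R) <= 0 by rewrite ler10.
  apply: (cvgr_to_ge wd); apply: filterS hw => k <-.
  by rewrite d0 subr0.
(* [q (T (b k))] stays bounded by Fejer monotonicity while the normalizing factor tends to zero. *)
have qd : q d = 0.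
  apply/eqP; rewrite eq_le qnorm_ge0 andbT.
  pose K := q (b 0%N - z) + q z.
  have bound_cvg0 :
      q (w k - d) + (hn (T (b k)))^-1 * K @[k --> F] --> (0 : R).
    rewrite -[X in _ --> X](addr0 0); apply: cvgD; first exact: qcvg.
    by rewrite -[X in _ --> X](mul0r K); exact: cvgMr_tmp.
  apply: (cvgr_to_ge bound_cvg0); apply: filterE => k.
  have := ler_qnormD Q_sym Q_psd (d - w k) (w k); rewrite subrK qnormB.
  move=> /le_trans; apply; rewrite lerD2l qnormZ.
  rewrite ger0_norm ?invr_ge0 ?hnorm_ge0 // ler_wpM2l ?invr_ge0 ?hnorm_ge0 //.
  have := ler_qnormD Q_sym Q_psd (T (b k) - z) z; rewrite subrK => /le_trans.
  apply; rewrite lerD2r; apply: le_trans (ppp_qnorm _ Tz) _.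
  exact: fejer_qnorm.
(* Divide [graph_bound] by the norm of [T (b k)] and pass to the limit. *)
have du x u : A x u -> ip d u <= 0.
  move=> Au; pose K := q (b 0%N - z) + q (z - x).
  have bound_cvg0 : (hn (T (b k)))^-1 * (ip x u + K * q (b k - T (b k)))
      @[k --> F] --> (0 : R).
    rewrite -[X in _ --> X](mul0r (ip x u + K * 0)); apply: cvgM => //.
    apply: cvgD; first exact: cvg_cst.
    by apply: cvgMl_tmp; exact: residual_ultra_cvg0.
  apply: (ler_cvg_to (hcvg_weak (z := u) wd) bound_cvg0); apply: filterE => k.
  rewrite ipZl ler_wpM2l ?invr_ge0 ?hnorm_ge0 // addrC -lerBlDr -linearBl.
  exact: graph_bound.
have Azd : A (z + d) 0.
  apply: maximally_monotoneP => x u Au; have [A_mon _] := A_maxmon.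
  rewrite [z + d - x]addrAC ipDl addr_ge0 //.
    exact: A_mon ((fixed_pointsP z).1 Tz) Au.
  by rewrite sub0r linearNr oppr_ge0; exact: du Au.
apply: d_neq0; apply: (addrI z); rewrite addr0.
apply: fixed_points_inj => //; first exact/fixed_pointsP.
by rewrite addrC addKr.
Qed.

(** In the limit, [graph_bound] gives [ip (t - x) u <= 0] on the whole graph of [A], so [0] lies in
    [A t] by maximality. *)
Lemma ppp_ultra_cvg :
  exists2 z, fixed_points T z & hn (T (b k) - z) @[k --> F] --> (0 : R).
Proof.
have [M TM] := ppp_ultra_bounded; have [t Tt] := ultra_hcvg FU TM.
exists t => //; apply/fixed_pointsP; apply: maximally_monotoneP => x u Au.
rewrite sub0r linearNr oppr_ge0.
have [z Tz] := FixT; pose K := q (b 0%N - z) + q (z - x).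
have bound_cvg : ip x u + K * q (b k - T (b k)) @[k --> F] --> ip x u.
  rewrite -[X in _ --> X]addr0 -[X in _ --> _ + X](mulr0 K).
  apply: cvgD; first exact: cvg_cst.
  by apply: cvgMl_tmp; exact: residual_ultra_cvg0.
rewrite linearBl subr_le0.
apply: (ler_cvg_to (hcvg_weak (z := u) Tt) bound_cvg); apply: filterE => k.
by rewrite addrC -lerBlDr -linearBl; exact: graph_bound.
Qed.

End UltraLimit.

(** * Convergence of the whole sequence *)

Lemma ppp_cvg :
  exists2 z, fixed_points T z & hn (T (b k) - z) @[k --> \oo] --> (0 : R).
Proof.
have [F [FU oF]] := ultraFilterLemma eventually_filter.
have [t Tt Ft] := ppp_ultra_cvg FU oF; exists t => //.
(* This distance is nonincreasing in [k], so one small value, found along [F], bounds all later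
   ones. *)
have qt : q (b k - t) @[k --> \oo] --> (0 : R).
  have Fqt : q (b k - T (b k)) + q (T (b k) - t) @[k --> F] --> (0 : R).
    rewrite -[X in _ --> X](addr0 0); apply: cvgD; last exact: qcvg.
    exact: residual_ultra_cvg0.
  apply/cvgr0Pnorm_lt => e e0.
  have [j /= jP] := filter_ex (@cvgr0_norm_lt _ _ _ _ _ _ Fqt e e0).
  exists j => // k /= jk; rewrite ger0_norm ?qnorm_ge0 //.
  apply: le_lt_trans (fejer_qnorm Tt jk) _; apply: le_lt_trans jP.
  apply: le_trans (ler_norm _).
  exact: (ler_qnorm_dist Q_sym Q_psd).
(* Any other ultrafilter limit [s] satisfies [q (t - s) = 0]: compare both points with [T (b k)]
   along [G], using [qt]. *)
apply: cvg_ultra => G GU oG.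
have [s Ts Gs] := ppp_ultra_cvg GU oG.
suff -> : t = s by [].
apply: fixed_points_inj => //; apply/eqP; rewrite eq_le qnorm_ge0 andbT.
have bound_cvg0 : q (b k - t) + q (T (b k) - s) @[k --> G] --> (0 : R).
  rewrite -[X in _ --> X](addr0 0); apply: cvgD; last exact: qcvg.
  by move=> B B0; apply: oG; exact: qt.
apply: (cvgr_to_ge bound_cvg0); apply: filterE => k.
apply: le_trans (ler_qnorm_dist Q_sym Q_psd _ (T (b k)) _) _.
by rewrite lerD2r qnormB; exact: ppp_qnorm.
Qed.

Lemma relaxed_ppp_cvg : exists2 z, fixed_points T z & hcvg ip b z.
Proof.
have [z Tz Tbz] := ppp_cvg; exists z => //.
(* The error [b k - z] contracts by [1 - gamma] up to the perturbation [gamma *: (T (b k) - z)],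
   which tends to zero. *)
apply: (@contraction_cvg0 _ `|1 - gamma| _ (fun k => gamma * hn (T (b k) - z))).
- rewrite normr_ge0 /= ltr_norml.
  by move: gamma_gt0 gamma_lt2 => g0 g2; apply/andP; split; lra.
- by move=> k; exact: hnorm_ge0.
- move=> k; rewrite b_step relaxedE.
  have -> : (1 - gamma) *: b k + gamma *: T (b k) - z
      = (1 - gamma) *: (b k - z) + gamma *: (T (b k) - z).
    by rewrite !scalerBr addrACA -opprD -scalerDl subrK scale1r.
  apply: le_trans (ler_hnormD _ _ _) _.
  by rewrite !hnormZ (gtr0_norm gamma_gt0).
- by rewrite -[X in _ --> X](mulr0 gamma); exact: cvgMl_tmp.
Qed.

End Iteration.
End PreconditionedProximalPoint.

Theorem theorem4p3 (R : realType) (H : vectType R) (ip : {dot H for idfun})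
    (A : H -> set H) (Q : {linear H -> H}) (T : H -> H)
    (gamma : R) (b0 : H) (b : nat -> H)
    (A_maxmon : maximally_monotone ip A)
    (Q_sym : symmetric_op ip Q)
    (Q_psd : positive_semidefinite ip Q)
    (T_def : forall x, ppp_op A Q x = [set T x])
    (FixT : fixed_points T !=set0)
    (gamma_bnd : 0 < gamma < 2)
    (b_init : b 0%N = b0)
    (b_step : forall k, b k.+1 = relaxed gamma T (b k)) :
  [/\ q_asymptotically_regular ip Q (relaxed gamma T),
      exists2 bstar, fixed_points T bstar & hcvg ip b bstar
    & forall bstar, fixed_points T bstar -> forall k : nat,
        qnorm ip Q (b k.+1 - b k)
          <= 1 / Num.sqrt (k.+1%:R) * Num.sqrt (gamma / (2 - gamma))
             * qnorm ip Q (b0 - bstar)].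
Proof.
split.
- move=> x.
  (* Regularity concerns every starting point, so the iteration is run from [x] rather than from
     [b0]. *)
  exact: (@step_qnorm_cvg0 _ _ _ _ _ _ A_maxmon Q_sym Q_psd T_def gamma
    (fun k => iter k (relaxed gamma T) x)).
- exact: (relaxed_ppp_cvg A_maxmon Q_sym Q_psd T_def gamma_bnd).
- move=> z Tz k; rewrite -b_init.
  exact: (step_qnorm_rate A_maxmon Q_sym Q_psd T_def gamma_bnd).
Qed.
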